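(* Let $n\ge 2$, $k\ge 1$ and $b\in B_n$. Then $b=h^{2k}$ for some half-twist $h\in B_n$ with $\pi(h)=(1,n)$ if and only if $b\in A_n$ and $b$ is conjugate to $a_{n-1}^k$ within $A_n$, i.e. $b=P^{-1}a_{n-1}^kP$ for some $P\in A_n$.
   Context: $B_n$ is Artin's braid group with generators $\sigma_1,\dots,\sigma_{n-1}$; $\pi:B_n\to S_n$ is the homomorphism with $\pi(\sigma_i)=(i,i+1)$. A half-twist is an element of the conjugacy class of $\sigma_1$ in $B_n$. For $1\le i\le n-1$ let $a_i=\sigma_1\cdots\sigma_{i-1}\sigma_i^2\sigma_{i-1}^{-1}\cdots\sigma_1^{-1}$, and let $A_n$ be the subgroup of $B_n$ generated by $a_1,\dots,a_{n-1}$ (the ''combed braids''); $A_n$ is a free group on $a_1,\dots,a_{n-1}$. *)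

(* Defs.v *)
(* The braid group B_n is given by its Artin presentation:
   elements are words in the letters sigma_i^{+-1} (1 <= i <= n-1), modulo
   the congruence generated by free cancellation and the braid relations. *)
From mathcomp Require Import all_boot all_fingroup.
Set Implicit Arguments. Unset Strict Implicit. Unset Printing Implicit Defensive.

(* a letter (true, i) is sigma_i, (false, i) is sigma_i^{-1} *)
Definition letter := (bool * nat)%type.
Definition word := seq letter.

Definition valid_letter (n : nat) (x : letter) : bool := (0 < x.2) && (x.2 < n).
Definition valid_word (n : nat) (w : word) : bool := all (valid_letter n) w.

Definition inv_letter (x : letter) : letter := (~~ x.1, x.2).
Definition inv_word (w : word) : word := rev (map inv_letter w).
Definition pow_word (w : word) (m : nat) : word := flatten (nseq m w).

Inductive braid_rel (n : nat) : word -> word -> Prop :=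
| BR_cancel x : valid_letter n x -> braid_rel n [:: x; inv_letter x] [::]
| BR_far i j : 0 < i < n -> 0 < j < n -> (i.+1 < j) || (j.+1 < i) ->
    braid_rel n [:: (true, i); (true, j)] [:: (true, j); (true, i)]
| BR_braid i : 0 < i -> i.+1 < n ->
    braid_rel n [:: (true, i); (true, i.+1); (true, i)]
                [:: (true, i.+1); (true, i); (true, i.+1)].

Inductive beq (n : nat) : word -> word -> Prop :=
| beq_rel p u v q : braid_rel n u v -> beq n (p ++ u ++ q) (p ++ v ++ q)
| beq_refl w : beq n w w
| beq_sym u v : beq n u v -> beq n v u
| beq_trans u v w : beq n u v -> beq n v w -> beq n u w.

(* the transposition of the points i and j (1-based) in S_n *)
Definition tr (n i j : nat) : 'S_n :=
  match (insub i.-1 : option 'I_n), (insub j.-1 : option 'I_n) with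
  | Some a, Some b => tperm a b
  | _, _ => 1%g
  end.

Definition perm_of_braid (n : nat) (w : word) : 'S_n :=
  (\prod_(x <- w) tr n x.2 x.2.+1)%g.

Definition half_twist (g : word) : word :=
  inv_word g ++ [:: (true, 1%N)] ++ g.

Definition a_word (i : nat) : word :=
  [seq (true, j) | j <- iota 1 i.-1] ++ [:: (true, i); (true, i)] ++
  [seq (false, j) | j <- rev (iota 1 i.-1)].

(* the element of A_n represented by a word s in the letters a_i^{+-1} *)
Definition a_eval (s : word) : word :=
  flatten [seq (if x.1 then a_word x.2 else inv_word (a_word x.2)) | x <- s].

Definition in_A (n : nat) (b : word) : Prop :=
  exists s : word, valid_word n s /\ beq n b (a_eval s).

(* Main.v *)
(* Put c_i = s_1 ... s_i. The braids s_j with j >= 2 normalise A_n, and conjugation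
   by s_j carries each a_i to an A_n-conjugate of a_{i'}, where s_j moves the point
   i + 1 to i' + 1. The relations c_i s_j = s_{j+1} c_i (j < i), c_i s_i = a_i c_{i-1}
   and c_i s_j = s_j c_i (j > i + 1) show that B_n is the union of the cosets
   <s_2, ..., s_{n-1}> A_n c_i, and c_i carries strand 1 to position i + 1; hence a
   braid g fixing strand 1 is v P with v in <s_2, ..., s_{n-1}> and P in A_n.
   If h = s_1^g has permutation (1, n), then after replacing g by s_1 g if needed
   g fixes 1 and carries 2 to n, so h^2 = a_1^(v P) is conjugate to a_{n-1} in A_n.
   Conversely a_{n-1} is the square of s_1^(s_2 ... s_{n-1}), a half-twist with
   permutation (1, n), and A_n consists of pure braids. *)
From HB Require Import structures.
From mathcomp Require Import boolp generic_quotient zify.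
Require Import Defs.
From mathcomp Require Import all_boot all_fingroup.
Set Implicit Arguments. Unset Strict Implicit. Unset Printing Implicit Defensive.

Section BraidGroup.
Local Open Scope group_scope.
Variable n : nat.

(** * Words modulo the braid relations *)

Lemma beq_cat u u' v v' : beq n u u' -> beq n v v' -> beq n (u ++ v) (u' ++ v').
Proof.
move=> uu' vv'; apply: (@beq_trans _ _ (u' ++ v)).
- elim: uu' => [p x y q r|w|x y _ /beq_sym //|x y z _ h _]; last exact: beq_trans.
  + by rewrite -!catA; apply: beq_rel.
  + exact: beq_refl.
- elim: vv' => [p x y q r|w|x y _ /beq_sym //|x y z _ h _]; last exact: beq_trans.
  + by rewrite !(catA u' p); apply: beq_rel.
  + exact: beq_refl.
Qed.

Lemma inv_letterK : involutive inv_letter.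
Proof. by case=> b i; rewrite /inv_letter negbK. Qed.

Lemma inv_wordK : involutive inv_word.
Proof. by move=> w; rewrite /inv_word map_rev revK mapK //; apply: inv_letterK. Qed.

Lemma inv_word_cat u v : inv_word (u ++ v) = inv_word v ++ inv_word u.
Proof. by rewrite /inv_word map_cat rev_cat. Qed.

Lemma valid_inv_word w : valid_word n (inv_word w) = valid_word n w.
Proof. by rewrite /valid_word /inv_word all_rev all_map. Qed.

Lemma beq_mulV w : valid_word n w -> beq n (w ++ inv_word w) [::].
Proof.
elim: w => [_|x w IH /andP[vx /IH h]]; first exact: beq_refl.
rewrite -[x :: w]cat1s inv_word_cat -catA (catA w).
apply: (@beq_trans _ _ ([:: x] ++ [::] ++ inv_word [:: x])).
  by do 2![apply: beq_cat => //; try exact: beq_refl].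
by have := beq_rel [::] [::] (BR_cancel vx).
Qed.

Lemma beq_mulVw w : valid_word n w -> beq n (inv_word w ++ w) [::].
Proof. by move=> vw; rewrite -{2}[w]inv_wordK; apply: beq_mulV; rewrite valid_inv_word. Qed.

(** Derived from $u^{-1}=u^{-1}vv^{-1}=u^{-1}uv^{-1}=v^{-1}$, so that no derivation has to be
    inverted. *)
Lemma beq_inv u v : valid_word n u -> valid_word n v ->
  beq n u v -> beq n (inv_word u) (inv_word v).
Proof.
move=> vu vv uv.
apply: (@beq_trans _ _ (inv_word u ++ (v ++ inv_word v))).
  by rewrite -{1}[inv_word u]cats0; apply: beq_cat (beq_refl _ _) (beq_sym (beq_mulV vv)).
rewrite catA -{2}[inv_word v]cat0s; apply: beq_cat (beq_refl _ _).
apply: beq_trans (beq_mulVw vu).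
by apply: beq_cat (beq_refl _ _) (beq_sym uv).
Qed.

(* Erasing the letters out of range makes every word represent a braid, so that
   the quotient is a group without restricting to valid words. *)
Definition valid_part (w : word) : word := filter (valid_letter n) w.

Lemma valid_part_valid w : valid_word n (valid_part w).
Proof. exact: filter_all. Qed.

Lemma valid_part_id w : valid_word n w -> valid_part w = w.
Proof. by move/all_filterP. Qed.

Lemma valid_part_cat u v : valid_part (u ++ v) = valid_part u ++ valid_part v.
Proof. exact: filter_cat. Qed.

Lemma valid_part_inv w : valid_part (inv_word w) = inv_word (valid_part w).
Proof. by rewrite /valid_part /inv_word filter_rev filter_map. Qed.

(** * The braid group as a quotient of all words *)

Definition same_braid : rel word :=
  fun u v => `[< beq n (valid_part u) (valid_part v) >].

Lemma same_braid_refl : reflexive same_braid.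
Proof. by move=> w; apply/asboolP; apply: beq_refl. Qed.

Lemma same_braid_sym : symmetric same_braid.
Proof. by move=> u v; apply/asboolP/asboolP; apply: beq_sym. Qed.

Lemma same_braid_trans : transitive same_braid.
Proof.
by move=> v u w /asboolP uv /asboolP vw; apply/asboolP; apply: beq_trans uv vw.
Qed.

Canonical same_braid_equiv :=
  EquivRel same_braid same_braid_refl same_braid_sym same_braid_trans.

Definition braid := {eq_quot same_braid}%qT.
HB.instance Definition _ := Choice.on braid.

Definition cls (w : word) : braid := (\pi_{eq_quot same_braid} w)%qT.

Lemma clsP u v : cls u = cls v <-> beq n (valid_part u) (valid_part v).
Proof.
by split=> [/eqmodP/asboolP|h] //; apply/eqmodP/asboolP.
Qed.

Lemma cls_beq u v : valid_word n u -> valid_word n v ->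
  cls u = cls v <-> beq n u v.
Proof. by move=> vu vv; rewrite clsP !valid_part_id. Qed.

Definition braid_mul (x y : braid) : braid :=
  cls (generic_quotient.repr x ++ generic_quotient.repr y).
Definition braid_inv (x : braid) : braid := cls (inv_word (generic_quotient.repr x)).

Lemma cls_repr x : cls (generic_quotient.repr x) = x.
Proof. exact: reprK. Qed.

Lemma braid_mulE u v : braid_mul (cls u) (cls v) = cls (u ++ v).
Proof. by apply/clsP; rewrite !valid_part_cat; apply: beq_cat; apply/clsP/cls_repr. Qed.

Lemma braid_invE u : braid_inv (cls u) = cls (inv_word u).
Proof.
apply/clsP; rewrite !valid_part_inv.
by apply: beq_inv; rewrite ?valid_part_valid //; apply/clsP/cls_repr.
Qed.

Lemma braid_ind (P : braid -> Prop) : (forall w, P (cls w)) -> forall x, P x.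
Proof. by move=> h x; rewrite -[x]cls_repr. Qed.

Lemma braid_mulA : associative braid_mul.
Proof.
elim/braid_ind=> x; elim/braid_ind=> y; elim/braid_ind=> z.
by rewrite !braid_mulE catA.
Qed.

Lemma braid_mul1 : left_id (cls [::]) braid_mul.
Proof. by elim/braid_ind=> x; rewrite braid_mulE. Qed.

Lemma braid_mulr1 : right_id (cls [::]) braid_mul.
Proof. by elim/braid_ind=> x; rewrite braid_mulE cats0. Qed.

Lemma braid_mulVx : left_inverse (cls [::]) braid_inv braid_mul.
Proof.
elim/braid_ind=> x; rewrite braid_invE braid_mulE; apply/clsP.
rewrite valid_part_cat valid_part_inv.
exact/beq_mulVw/valid_part_valid.
Qed.

Lemma braid_mulxV : right_inverse (cls [::]) braid_inv braid_mul.
Proof.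
elim/braid_ind=> x; rewrite braid_invE braid_mulE; apply/clsP.
rewrite valid_part_cat valid_part_inv.
exact/beq_mulV/valid_part_valid.
Qed.

HB.instance Definition _ := isGroup.Build braid
  braid_mulA braid_mul1 braid_mulr1 braid_mulVx braid_mulxV.

Lemma cls_nil : cls [::] = 1.
Proof. by []. Qed.

Lemma cls_cat u v : cls (u ++ v) = cls u * cls v.
Proof. by rewrite -braid_mulE. Qed.

Lemma cls_inv u : cls (inv_word u) = (cls u)^-1.
Proof. by rewrite -braid_invE. Qed.

Lemma cls_pow u m : cls (pow_word u m) = cls u ^+ m.
Proof. by elim: m => [|m IH] //; rewrite expgS -IH -cls_cat. Qed.

Lemma cls_invalid x : ~~ valid_letter n x -> cls [:: x] = 1.
Proof. by move=> /negPf vx; apply/clsP; rewrite /= vx; apply: beq_refl. Qed.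

(** * Artin generators and the products $c_i$ *)

Definition sigma (i : nat) : braid := cls [:: (true, i)].

Lemma cls_neg i : cls [:: (false, i)] = (sigma i)^-1.
Proof. by rewrite -cls_inv. Qed.

Lemma cls_braid_rel u v : braid_rel n u v -> cls u = cls v.
Proof.
move=> r; have := beq_rel [::] [::] r; rewrite /= !cats0 => h; apply/cls_beq => //.
- case: r => [x vx|i j iN jN _|i i0 iN]; rewrite /= /valid_letter /=; try lia.
  by move: vx; rewrite /valid_letter => ->.
- by case: r => [x vx|i j iN jN _|i i0 iN]; rewrite /= /valid_letter /=; lia.
Qed.

Lemma sigma_far i j : i.+1 < j -> commute (sigma i) (sigma j).
Proof.
(* A letter out of range is erased, hence trivial, and commutes with everything. *)
move=> ij; case: (boolP (valid_letter n (true, i))) => vi; last first.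
  by rewrite /sigma (cls_invalid vi); apply/commute_sym/commute1.
case: (boolP (valid_letter n (true, j))) => vj; last first.
  by rewrite /sigma (cls_invalid vj); apply: commute1.
by rewrite /commute -!cls_cat; apply: cls_braid_rel; apply: BR_far; rewrite ?ij.
Qed.

Lemma sigma_braid i : 0 < i -> i.+1 < n ->
  sigma i * sigma i.+1 * sigma i = sigma i.+1 * sigma i * sigma i.+1.
Proof. 
have cls3 x y z : cls [:: x] * cls [:: y] * cls [:: z] = cls [:: x; y; z].
  by rewrite -mulgA -(cls_cat [:: y]) -(cls_cat [:: x]).
by move=> i0 i1; rewrite /sigma !cls3; apply: cls_braid_rel; apply: BR_braid.
Qed.

(* [cycle_word i] carries strand [1] to position [i + 1]; these words represent
   the cosets of the stabiliser of strand [1]. *)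
Definition cycle_word (i : nat) : word := [seq (true, j) | j <- iota 1 i].
Definition cycle_braid (i : nat) : braid := cls (cycle_word i).

Lemma cycle_wordS i : cycle_word i.+1 = cycle_word i ++ [:: (true, i.+1)].
Proof. by rewrite /cycle_word -{1}[i.+1]addn1 iotaD map_cat. Qed.

Lemma cycle_braidS i : cycle_braid i.+1 = cycle_braid i * sigma i.+1.
Proof. by rewrite /cycle_braid cycle_wordS cls_cat. Qed.

Lemma cycle_comm i j : i.+1 < j -> commute (sigma j) (cycle_braid i).
Proof.
elim: i => [|i IH] ij; first exact: commute1.
rewrite cycle_braidS; apply: commuteM; first by apply: IH; lia.
by apply/commute_sym/sigma_far.
Qed.

(** Moving left through $c_i$, $\sigma_j$ commutes with the letters beyond $\sigma_{j+1}$; the braid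
    relation at $\sigma_j\sigma_{j+1}$ turns it into $\sigma_{j+1}$, which commutes with the
    rest. *)
Lemma cycle_shift i j : 0 < j < i -> i < n ->
  cycle_braid i * sigma j = sigma j.+1 * cycle_braid i.
Proof.
elim: i => [|i IH] ji iN; first lia.
have [e|ne] := eqVneq i j.
  rewrite e in iN ji *; case: j e iN ji {IH} => // j e iN ji.
  rewrite !cycle_braidS -!mulgA (mulgA (sigma j.+1)) sigma_braid //.
  by rewrite !mulgA cycle_comm.
rewrite cycle_braidS -mulgA -sigma_far; last lia.
by rewrite mulgA IH ?mulgA //; lia.
Qed.

(** * The generators $a_i$ and their conjugates by the $\sigma_j$ *)

Definition agen (i : nat) : braid := cls (a_word i).

Lemma a_wordE i : a_word i.+1 =
  cycle_word i ++ [:: (true, i.+1); (true, i.+1)] ++ inv_word (cycle_word i).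
Proof.
by rewrite /a_word /cycle_word /inv_word /= -map_comp -map_rev.
Qed.

(** Since [x ^ y] is $y^{-1}xy$, the conjugator in $a_{i+1}=c_i\sigma_{i+1}^2c_i^{-1}$ enters
    inverted. *)
Lemma agenE i : agen i.+1 = (sigma i.+1 ^+ 2) ^ (cycle_braid i)^-1.
Proof.
by rewrite /agen a_wordE !cls_cat cls_inv -cat1s cls_cat conjgE invgK !mulgA.
Qed.

Lemma commute_conj (G : groupType) (x y : G) : commute x y -> x ^ y = x.
Proof. by move=> c; rewrite conjgE c mulKg. Qed.

(** If $j>i+2$, [sigma j] commutes with every letter of $a_{i+1}$. If $j\le i$, [cycle_shift] writes
    it as $c_i\sigma_{j-1}c_i^{-1}$, and $\sigma_{j-1}$ commutes with $\sigma_{i+1}$. *)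
Lemma agen_fix i j : 1 < j -> j != i.+1 -> j != i.+2 -> i.+1 < n ->
  agen i.+1 ^ sigma j = agen i.+1.
Proof.
move=> j1 ji ji1 iN; rewrite agenE; have [lt|ge] := ltnP i.+1 j.
  rewrite conjgE; apply: (canLR (mulKg _)).
  apply: commute_sym; rewrite conjgE invgK.
  apply: commuteM; first by apply: cycle_comm; lia.
  apply: commuteM; last by apply/commuteV/cycle_comm; lia.
  by apply/commuteX/commute_sym/sigma_far; lia.
case: j j1 ji ji1 ge => // j j1 ji ji1 ge.
have -> : sigma j.+1 = cycle_braid i * sigma j * (cycle_braid i)^-1.
  by rewrite cycle_shift ?mulgK //; lia.
rewrite -conjgM !mulgA mulVg mul1g conjgM; congr (_ ^ _).
by apply/commute_conj/commute_sym/commuteX/sigma_far; lia.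
Qed.

Section BraidPair.
Variables (G : groupType) (x y : G).
Hypothesis xyx : x * y * x = y * x * y.

Lemma braid_pair_conj : x ^ y = y ^ x^-1.
Proof.
by rewrite !conjgE invgK; apply: (canLR (mulKg _)); rewrite !mulgA -xyx mulgK.
Qed.

Lemma braid_pair_conjV : x ^ (y ^ x^-1)^-1 = y.
Proof.
rewrite !conjgE !invgK !invgM !invgK; rewrite !mulgA mulgVK.
by rewrite xyx !mulgK.
Qed.

End BraidPair.

(** With $z=y^{x^{-1}}$, [braid_pair_conjV] reduces the right side to $y^{z^{-1}}$. What remains is
    [braid_pair_conj] for the pair $(z,y)$, whose braid relation is that of $(x,y)$ conjugated by
    $y$, as $z=x^y$. *)
Lemma braid_pair_conj2 (G : groupType) (x y : G) : x * y * x = y * x * y ->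
  (y ^ x^-1) ^ y = (x ^ (y ^ x^-1)^-1) ^ (y ^ x^-1)^-1.
Proof.
move=> xyx; rewrite (braid_pair_conjV xyx) -(braid_pair_conj xyx).
apply: braid_pair_conj.
by have := congr1 (conjg^~ y) xyx; rewrite /= !conjMg (commute_conj (commute_refl y)).
Qed.

(** As $\sigma_{i+2}$ commutes with $c_i$, the conjugation by $c_i^{-1}$ can be set aside; what
    remains is the square of [braid_pair_conj]. *)
Lemma agen_up i : i.+2 < n -> agen i.+1 ^ sigma i.+2 = agen i.+2.
Proof.
move=> iN; have c := cycle_comm (ltnSn i.+1).
have br := sigma_braid (ltn0Sn i) iN.
rewrite !agenE cycle_braidS invgM -conjgM.
rewrite -(commuteV c) // conjgM [in RHS]conjgM; congr (_ ^ _).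
by rewrite !conjXg (braid_pair_conj br).
Qed.

(** Once the conjugation by $c_i^{-1}$ is set aside, $a_{i+2}$ is $z^2$ with
    $z=\sigma_{i+1}\sigma_{i+2}\sigma_{i+1}^{-1}$; the two conjugations by $z^{-1}$ in
    [braid_pair_conj2] make one by $a_{i+2}^{-1}$. *)
Lemma agen_down i : i.+2 < n ->
  agen i.+2 ^ sigma i.+2 = agen i.+1 ^ (agen i.+2)^-1.
Proof.
move=> iN; have c := cycle_comm (ltnSn i.+1).
have br := sigma_braid (ltn0Sn i) iN.
have e : agen i.+2 = ((sigma i.+2 ^ (sigma i.+1)^-1) ^+ 2) ^ (cycle_braid i)^-1.
  by rewrite agenE cycle_braidS invgM conjgM conjXg.
rewrite e [agen i.+1]agenE -conjVg -conjJg -[LHS]conjgM -(commuteV c) [LHS]conjgM.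
congr (_ ^ _); rewrite !conjXg (braid_pair_conj2 br) -conjgM. congr ((_ ^ _) ^+ _).
by rewrite -expVgn.
Qed.

(** * The subgroup $A_n$ *)

Definition inA (x : braid) : Prop := exists2 s, valid_word n s & x = cls (a_eval s).

Lemma inA1 : inA 1.
Proof. by exists [::]. Qed.

Lemma inAM x y : inA x -> inA y -> inA (x * y).
Proof.
move=> [s vs ->] [t vt ->]; exists (s ++ t).
  by rewrite /valid_word all_cat; apply/andP.
by rewrite /a_eval map_cat flatten_cat cls_cat.
Qed.

Lemma inA_gen i : 0 < i < n -> inA (agen i).
Proof.
move=> i0; exists [:: (true, i)]; first by rewrite /= /valid_letter /= andbT.
by rewrite /a_eval /= cats0.
Qed.

Lemma inA_genV i : 0 < i < n -> inA (agen i)^-1.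
Proof.
move=> i0; exists [:: (false, i)]; first by rewrite /= /valid_letter /= andbT.
by rewrite /a_eval /= cats0 cls_inv.
Qed.

Lemma inA_ind (P : braid -> Prop) : P 1 ->
  (forall i x, 0 < i < n -> inA x -> P x -> P (agen i * x)) ->
  (forall i x, 0 < i < n -> inA x -> P x -> P ((agen i)^-1 * x)) ->
  forall x, inA x -> P x.
Proof.
move=> P1 PM PV x [s vs ->]; elim: s vs => // [[b i] s] IH /= /andP[vi vs].
rewrite /a_eval /= cls_cat; case: b vi => vi.
- by apply: PM (IH vs); last exists s.
- by rewrite cls_inv; apply: PV (IH vs); last exists s.
Qed.

Lemma inAV x : inA x -> inA x^-1.
Proof.
elim/inA_ind => [|i {}x vi _ h|i {}x vi _ h]; rewrite ?invg1 ?invgM ?invgK.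
- exact: inA1.
- exact/inAM/inA_genV.
- exact/inAM/inA_gen.
Qed.

Lemma inAJ x y : inA x -> inA y -> inA (x ^ y).
Proof. by move=> hx hy; rewrite conjgE; apply/inAM/inAM => //; apply: inAV. Qed.

Lemma inAX x m : inA x -> inA (x ^+ m).
Proof. by move=> hx; elim: m => [|m IH]; [apply: inA1|rewrite expgS; apply: inAM]. Qed.

(** * Permutations of braids *)

Lemma trV i j : (tr n i j)^-1 = tr n i j.
Proof. by rewrite /tr; case: insub => [a|]; [case: insub => [b|]|]; rewrite ?invg1 ?tpermV. Qed.

(** Makes permutations compatible with erasing letters: for index 0 both points are 0 because [0.-1]
    is 0, and for an index at least [n] the second [insub] fails. *)
Lemma tr_invalid x : ~~ valid_letter n x -> tr n x.2 x.2.+1 = 1.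
Proof.
rewrite /valid_letter /tr => vx; case: insubP => // a _ ea; case: insubP => // b ltb eb.
rewrite (_ : a = b) ?tperm1 //; apply: val_inj; rewrite ea eb /=.
by move: ltb vx; case: (x.2) => //= m ->.
Qed.

(** Reduces identities between permutations to case analysis on natural numbers; points count from
    0, so strand $j$ is the point $j-1$. *)
Lemma tr_val j (i : 'I_n) : 0 < j < n ->
  tr n j j.+1 i = (if i == j.-1 :> nat then j else if i == j :> nat then j.-1 else i) :> nat.
Proof.
move=> jN; rewrite /tr; case: insubP => [a _ ea|]; last lia.
case: insubP => [b _ eb|]; last by rewrite /=; lia.
have {}ea : a = j.-1 :> nat := ea; have {}eb : b = j :> nat := eb.
have [->|neb] := eqVneq i b; last have [->|nea] := eqVneq i a.
- rewrite tpermR; do 2?case: eqP; lia.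
- rewrite tpermL; do 2?case: eqP; lia.
rewrite tpermD; first 1 last; [by rewrite eq_sym|by rewrite eq_sym|].
by move: nea neb; rewrite -!val_eqE /= ea eb => /negPf-> /negPf->.
Qed.

Local Notation pi := (perm_of_braid n).

Lemma perm_cat u v : pi (u ++ v) = pi u * pi v.
Proof. exact: big_cat. Qed.

Lemma perm_letter x : pi [:: x] = tr n x.2 x.2.+1.
Proof. exact: big_seq1. Qed.

Lemma perm_inv w : pi (inv_word w) = (pi w)^-1.
Proof.
elim: w => [|x w IH]; first by rewrite /perm_of_braid /inv_word big_nil invg1.
by rewrite -[x :: w]cat1s inv_word_cat !perm_cat invgM IH !perm_letter trV.
Qed.

Lemma perm_valid_part w : pi (valid_part w) = pi w.
Proof.
elim: w => //= x w IH; rewrite -[x :: w]cat1s perm_cat -IH; case: ifP => vx.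
  by rewrite -perm_cat.
by rewrite perm_letter tr_invalid ?vx // mul1g.
Qed.

Lemma perm_braid_rel u v : braid_rel n u v -> pi u = pi v.
Proof.
case=> [x vx|i j iN jN ij|i i0 iN].
- by rewrite (perm_cat [:: x] [:: _]) !perm_letter -[X in _ * X]trV mulgV /perm_of_braid big_nil.
- rewrite /perm_of_braid !big_cons big_nil; apply/permP=> p; apply: val_inj.
  by rewrite /= !permE /= !permM !perm1 /= !tr_val //; do ![case: eqP]; lia.
- rewrite /perm_of_braid !big_cons big_nil; apply/permP=> p; apply: val_inj.
  by rewrite /= !permM !perm1 /= !tr_val; try lia; do ![case: eqP]; lia.
Qed.

Lemma perm_cls u v : cls u = cls v -> pi u = pi v.
Proof.
move/clsP; rewrite -(perm_valid_part u) -(perm_valid_part v).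
elim=> [p x y q /perm_braid_rel e|//|x y _ //|x y z _ -> _ ->] //.
by rewrite !perm_cat e.
Qed.

Lemma perm_agen i : pi (a_word i.+1) = 1.
Proof.
rewrite a_wordE !perm_cat perm_inv -[[:: _; _]]cat1s perm_cat !perm_letter.
by rewrite -[X in _ * (_ * X * _)]trV mulgV mul1g mulgV.
Qed.

Lemma perm_a_eval s : valid_word n s -> pi (a_eval s) = 1.
Proof.
elim: s => [|[b [|i]] s IH] //=; first by rewrite /perm_of_braid big_nil.
move=> /andP[_ /IH e]; rewrite /a_eval /= perm_cat e mulg1.
by case: b; rewrite ?perm_inv perm_agen ?invg1.
Qed.

Lemma perm_cycle i (p : 'I_n) : i < n -> p = 0 :> nat ->
  pi (cycle_word i) p = i :> nat.
Proof.
move=> iN p0; elim: i iN => [|i IH] iN; first by rewrite /perm_of_braid big_nil perm1.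
rewrite cycle_wordS perm_cat permM perm_letter tr_val //= IH ?eqxx //; lia.
Qed.

(** * Braids in $\sigma_2,\dots,\sigma_{n-1}$, their action on $A_n$, and the cosets *)

Definition upper_word (w : word) : bool := all (fun x : letter => 1 < x.2 < n) w.

Lemma perm_upper w (p : 'I_n) : upper_word w -> p = 0 :> nat -> pi w p = 0 :> nat.
Proof.
elim: w p => [|x w IH] p; first by rewrite /perm_of_braid big_nil perm1.
move=> /= /andP[vx vw] p0; rewrite -[x :: w]cat1s perm_cat permM IH //.
by rewrite perm_letter tr_val ?p0; [do 2?case: eqP|]; lia.
Qed.

(** The braid $a_i$ links strand 1 with strand $i+1$, which is the point [i] counted from 0, so the
    permutation acts on the index itself. *)
Lemma agenJ_letter b j (i : 'I_n) : 1 < j < n -> 0 < i ->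
  exists2 P, inA P & agen i ^ cls [:: (b, j)] = agen (tr n j j.+1 i) ^ P.
Proof.
move=> jN i0; rewrite tr_val; last lia.
case: i i0 => /= [] [//|i] iN _.
case: j jN => [//|[//|j]] jN.
have [/= e1|n1] := eqVneq i.+1 j.+1.
  case: e1 iN => -> iN; case: b.
    by exists 1; [exact: inA1|rewrite conjg1 agen_up].
  (* For the inverse letter, [agen_down] is conjugated by [agen j.+2], the image of [agen j.+1]
     under [sigma j.+2]. *)
  exists (agen j.+1); first by apply: inA_gen; lia.
  rewrite cls_neg; apply: (canLR (conjgKV _)).
  rewrite invgK conjJg agen_down // agen_up //.
  by rewrite conjgKV.
have [/= e1|n2] := eqVneq i.+1 j.+2.
  case: e1 iN => -> iN; case: b.
    by exists (agen j.+2)^-1; [apply: inA_genV; lia|rewrite agen_down].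
  exists 1; first exact: inA1.
  by rewrite cls_neg conjg1 -(@agen_up j) // conjgK.
exists 1; first exact: inA1.
have h : agen i.+1 ^ sigma j.+2 = agen i.+1 by apply: agen_fix => //; lia.
by rewrite conjg1; case: b => //; rewrite cls_neg -{1}h conjgK.
Qed.

Lemma inA_letterJ b j x : 1 < j < n -> inA x -> inA (x ^ cls [:: (b, j)]).
Proof.
move=> jN; have hg i : 0 < i < n -> inA (agen i ^ cls [:: (b, j)]).
  move=> /andP[i0 iN]; have [P hP e] := agenJ_letter b (i := Ordinal iN) jN i0.
  rewrite e; apply: inAJ => //; apply: inA_gen; rewrite ltn_ord andbT tr_val /=; last lia.
  by do 2?case: eqP; lia.
elim/inA_ind => [|i {}x vi _ h|i {}x vi _ h]; rewrite ?conj1g ?conjMg ?conjVg.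
- exact: inA1.
- exact: inAM (hg i vi) h.
- exact: inAM (inAV (hg i vi)) h.
Qed.

Lemma inA_upperJ w x : upper_word w -> inA x -> inA (x ^ cls w).
Proof.
elim: w x => [|[b j] w IH] x; first by rewrite cls_nil conjg1.
move=> /= /andP[jN vw] hx; rewrite -[_ :: w]cat1s cls_cat conjgM.
exact/IH/inA_letterJ.
Qed.

Lemma agenJ_upper w (i : 'I_n) : upper_word w -> 0 < i ->
  exists2 P, inA P & agen i ^ cls w = agen (pi w i) ^ P.
Proof.
elim: w i => [|[b j] w IH] i /=.
  by exists 1; [exact: inA1|rewrite cls_nil /perm_of_braid big_nil perm1].
move=> /andP[jN vw] i0; rewrite -[_ :: w]cat1s cls_cat perm_cat permM perm_letter /=.
have [P hP e] := agenJ_letter b jN i0.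
have i'0 : 0 < tr n j j.+1 i by rewrite tr_val; [do 2?case: eqP|]; lia.
have [Q hQ e'] := IH _ vw i'0.
(* Conjugation by the remaining letters carries [P] to [P ^ cls w], still in $A_n$. *)
exists (Q * P ^ cls w); first by apply: inAM => //; apply: inA_upperJ.
by rewrite conjgM e conjJg e' -conjgM.
Qed.

(** Induction on the last letter: the union of the cosets is stable under right multiplication by
    each $\sigma_j^{\pm1}$. *)
Lemma coset_decomposition w : 0 < n -> valid_word n w ->
  exists v P i, [/\ upper_word v, inA P, i < n &
    cls w = cls v * P * cycle_braid i].
Proof.
move=> n0; elim/last_ind: w => [_|w [b j] IH].
  by exists [::], 1, 0; split => //; [exact: inA1|rewrite !mulg1].
rewrite -cats1 /valid_word all_cat => /andP[/IH[v [P [i [vv hP iN e]]]]].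
rewrite /= andbT /valid_letter /= => jN; rewrite cls_cat e.
(* The letter passes $c_i$ as some $\sigma_k^{\pm1}$ with $k\ge2$, which then passes [P] by
   normality. *)
have Bcase k : 1 < k < n ->
    cycle_braid i * cls [:: (b, j)] = cls [:: (b, k)] * cycle_braid i ->
    exists v' P' i', [/\ upper_word v', inA P', i' < n &
      cls v * P * cycle_braid i * cls [:: (b, j)] = cls v' * P' * cycle_braid i'].
  move=> kN ek; exists (v ++ [:: (b, k)]), (P ^ cls [:: (b, k)]), i; split => //.
  - by rewrite /upper_word all_cat /= kN; apply/andP.
  - exact: inA_letterJ.
  - by rewrite cls_cat -mulgA ek -!mulgA mulVKg.
(* The letter replaces $c_i$ by $c_{i'}$ and leaves a factor in $A_n$. *)
have Acase Q i' : inA Q -> i' < n ->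
    cycle_braid i * cls [:: (b, j)] = Q * cycle_braid i' ->
    exists v' P' i', [/\ upper_word v', inA P', i' < n &
      cls v * P * cycle_braid i * cls [:: (b, j)] = cls v' * P' * cycle_braid i'].
  move=> hQ i'N ek; exists v, (P * Q), i'; split => //; first exact: inAM.
  by rewrite -mulgA ek !mulgA.
have [ij|ij|ij] := ltngtP j i.
- have h : cycle_braid i * sigma j = sigma j.+1 * cycle_braid i by apply: cycle_shift; lia.
  apply: (Bcase j.+1); first lia.
  case: b {Bcase Acase} => //; rewrite !cls_neg.
  by apply: (canLR (mulgK _)); rewrite -mulgA h mulKg.
- have [e1|n1] := eqVneq j i.+1.
    subst j; case: b {Bcase} Acase => Acase.
      by apply: (Acase 1 i.+1); [exact: inA1|lia|rewrite mul1g cycle_braidS].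
    (* From $c_{i+1}\sigma_{i+1}=a_{i+1}c_i$ follows $c_i\sigma_{i+1}^{-1}=a_{i+1}^{-1}c_{i+1}$. *)
    apply: (Acase (agen i.+1)^-1 i.+1); [exact: inA_genV|lia|].
    rewrite cls_neg agenE cycle_braidS -conjVg conjgE invgK !mulgA mulgVK.
    by rewrite expg2 invgM !mulgA mulgVK.
  have c : commute (sigma j) (cycle_braid i) by apply: cycle_comm; lia.
  apply: (Bcase j); first lia.
  case: b {Bcase Acase} => //.
  by rewrite cls_neg; apply/commuteV/commute_sym.
- subst i; case: j {IH e iN} jN Bcase Acase => // j jN _; case: b => Acase.
    apply: (Acase (agen j.+1) j); [exact: inA_gen|lia|].
    by rewrite agenE cycle_braidS conjgE invgK expg2 !mulgA mulgVK.
  apply: (Acase 1 j); [exact: inA1|lia|].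
  by rewrite cls_neg cycle_braidS mulgK mul1g.
Qed.

(** * Squares of half-twists *)

Lemma agen1 : agen 1 = sigma 1 ^+ 2.
Proof. by rewrite agenE invg1 conjg1. Qed.

Lemma agen1J_stabiliser g (o0 o1 : 'I_n) : valid_word n g ->
  o0 = 0 :> nat -> o1 = 1%N :> nat -> pi g o0 = o0 ->
  exists2 P, inA P & agen 1 ^ cls g = agen (pi g o1) ^ P.
Proof.
move=> vg e0 e1 fix0.
have n0 : 0 < n by case: (n) o0 {e0 fix0} => // [[]].
have [v [P [i [vv hP iN e]]]] := coset_decomposition n0 vg.
have [s vs Pe] := hP.
have ep : pi g = pi v * pi (cycle_word i).
  have -> : pi g = pi (v ++ a_eval s ++ cycle_word i).
    by apply: perm_cls; rewrite !cls_cat e Pe mulgA.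
  by rewrite !perm_cat perm_a_eval // mul1g.
(* Since [v] fixes the point 0 and $A_n$ is pure, [g] sends 0 to where $c_i$ sends it, namely
   [i]. *)
have i0 : i = 0.
  by rewrite -(perm_cycle iN (perm_upper vv e0)) -permM -ep fix0.
rewrite i0 in e ep; rewrite e mulg1 ep /cycle_word /= {2}/perm_of_braid big_nil mulg1.
have o10 : 0 < o1 by rewrite e1.
have [Q hQ eQ] := agenJ_upper vv o10.
exists (Q * P); first exact: inAM.
by rewrite -e1 !conjgM eQ.
Qed.

Lemma cls_half_twist g : cls (half_twist g) = sigma 1 ^ cls g.
Proof. by rewrite /half_twist !cls_cat cls_inv. Qed.

Lemma tr_tperm (i j : 'I_n) : tr n i.+1 j.+1 = tperm i j.
Proof. by rewrite /tr /= !valK. Qed.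

Lemma perm_half_twist g (o0 o1 : 'I_n) : o0 = 0 :> nat -> o1 = 1%N :> nat ->
  pi (half_twist g) = tperm (pi g o0) (pi g o1).
Proof.
move=> e0 e1; rewrite /half_twist !perm_cat perm_inv perm_letter /=.
by rewrite -{1}e0 -e1 tr_tperm -tpermJ.
Qed.

Lemma half_twist_sqr g : 1 < n -> valid_word n g -> pi (half_twist g) = tr n 1 n ->
  exists2 P, inA P & (sigma 1 ^+ 2) ^ cls g = agen n.-1 ^ P.
Proof.
move=> n1 vg; have n0 := ltnW n1; have nN : n.-1 < n by rewrite prednK.
pose o0 := Ordinal n0; pose o1 := Ordinal n1; pose om := Ordinal nN.
have -> : tr n 1 n = tperm o0 om by rewrite -(tr_tperm o0 om) /= prednK.
rewrite (@perm_half_twist g o0 o1) // => eq_tr.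
have := congr1 (fun s : 'S_n => s o0) eq_tr; rewrite /= tpermL.
(* Either [g] sends the points 0 and 1 to 0 and $n-1$ in one of the two orders, or $0=n-1$, which is
   impossible. *)
case: tpermP => [fix0 em|sw0 em|_ _ /(congr1 val) /= e]; last by lia.
- have [P hP e] := @agen1J_stabiliser g o0 o1 vg erefl erefl (esym fix0).
  by exists P => //; rewrite -agen1 e em.
(* g exchanges the two end points: replace it by sigma_1 g *)
have vg' : valid_word n ((true, 1%N) :: g) by rewrite /= /valid_letter n1.
have ep : pi ((true, 1%N) :: g) = tperm o0 o1 * pi g.
  by rewrite -[_ :: g]cat1s perm_cat perm_letter /= (tr_tperm o0 o1).
have fix0 : pi ((true, 1%N) :: g) o0 = o0 by rewrite ep permM tpermL -sw0.
have [P hP e] := @agen1J_stabiliser _ o0 o1 vg' erefl erefl fix0.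
exists P => //; rewrite ep permM tpermR em in e; rewrite -e agen1.
(* The extra $\sigma_1$ is absorbed, as it commutes with $\sigma_1^2$. *)
rewrite -[_ :: g]cat1s cls_cat conjgM; congr (_ ^ _).
by rewrite conjXg (commute_conj (commute_refl _)).
Qed.

(** * A half-twist with square $a_{n-1}$ *)

Definition tail_word (i : nat) : word := [seq (true, j) | j <- iota 2 i].

Lemma tail_wordS i : tail_word i.+1 = tail_word i ++ [:: (true, i.+2)].
Proof. by rewrite /tail_word -{1}[i.+1]addn1 iotaD map_cat. Qed.

Lemma upper_tail i : i.+1 < n -> upper_word (tail_word i).
Proof.
move=> iN; rewrite /upper_word all_map; apply/allP=> j /=.
by rewrite mem_iota; lia.
Qed.

(** Each new letter $\sigma_{i+2}$ commutes with $c_i$, which leaves [braid_pair_conj] for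
    $\sigma_{i+1},\sigma_{i+2}$. Squared, the identity exhibits $a_{i+1}$ as the square of a
    half-twist. *)
Lemma sigma1J_tail i : i.+1 < n ->
  sigma 1 ^ cls (tail_word i) = sigma i.+1 ^ (cycle_braid i)^-1.
Proof.
elim: i => [|i IH] iN; first by rewrite invg1.
have c := cycle_comm (ltnSn i.+1).
rewrite tail_wordS cls_cat conjgM IH; last lia.
rewrite -conjgM -(commuteV c) conjgM cycle_braidS invgM conjgM; congr (_ ^ _).
exact: braid_pair_conj (sigma_braid (ltn0Sn i) iN).
Qed.

Lemma perm_tail i (p : 'I_n) : i.+1 < n -> p = 1%N :> nat ->
  pi (tail_word i) p = i.+1 :> nat.
Proof.
move=> + p0; elim: i => [|i IH] iN; first by rewrite /perm_of_braid big_nil perm1.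
rewrite tail_wordS perm_cat permM perm_letter tr_val //= IH ?eqxx //; lia.
Qed.

(** * Validity of words and the passage to the quotient *)

Lemma valid_upper w : upper_word w -> valid_word n w.
Proof. by apply: sub_all => x /andP[h1 h2]; rewrite /valid_letter h2 andbT ltnW. Qed.

Lemma valid_cat u v : valid_word n (u ++ v) = valid_word n u && valid_word n v.
Proof. exact: all_cat. Qed.

Lemma valid_pow w m : valid_word n w -> valid_word n (pow_word w m).
Proof. by move=> vw; elim: m => //= m IH; rewrite /pow_word /= valid_cat vw. Qed.

Lemma valid_half_twist g : 1 < n -> valid_word n g -> valid_word n (half_twist g).
Proof.
by move=> n1 vg; rewrite /half_twist !valid_cat valid_inv_word vg /= /valid_letter n1.
Qed.

Lemma valid_a_word i : 0 < i < n -> valid_word n (a_word i).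
Proof.
case: i => // i iN; rewrite a_wordE !valid_cat valid_inv_word /= /valid_letter /=.
have -> : valid_word n (cycle_word i).
  rewrite /valid_word all_map; apply/allP=> j /=.
  by rewrite mem_iota /valid_letter /=; lia.
by rewrite /=; lia.
Qed.

Lemma valid_a_eval s : valid_word n s -> valid_word n (a_eval s).
Proof.
elim: s => //= [[b i] s] IH /andP[vi /IH vs].
by rewrite /a_eval /= valid_cat vs; case: b vi => /valid_a_word; rewrite ?valid_inv_word => ->.
Qed.

Lemma in_AP w : valid_word n w -> in_A n w <-> inA (cls w).
Proof.
move=> vw; split=> [[s [vs h]]|[s vs h]]; exists s => //.
  by apply/cls_beq => //; apply: valid_a_eval.
by split => //; apply/cls_beq => //; apply: valid_a_eval.
Qed.

End BraidGroup.

Theorem theorem3p6 (n k : nat) (b : word) :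
  2 <= n -> 1 <= k -> valid_word n b ->
  ((exists g : word, valid_word n g /\
      perm_of_braid n (half_twist g) = tr n 1 n /\
      beq n b (pow_word (half_twist g) (2 * k)))
   <->
   (in_A n b /\
    exists P : word, valid_word n P /\ in_A n P /\
      beq n b (inv_word P ++ pow_word (a_word n.-1) k ++ P))).
Proof.
move=> n1 _ vb; have n0 := ltnW n1; have nN : 0 < n.-1 < n by lia.
have hA : inA (agen n n.-1) by exact: inA_gen.
(* Regrouping $h^{2k}$ as $(h^2)^k$ leaves only the square of the half-twist to be compared with
   $a_{n-1}$. *)
have clsL g : cls n (pow_word (half_twist g) (2 * k)) =
    (((sigma n 1 ^+ 2) ^ cls n g) ^+ k)%g.
  by rewrite cls_pow cls_half_twist expgnA conjXg.
have clsR P : cls n (inv_word P ++ pow_word (a_word n.-1) k ++ P) =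
    ((agen n n.-1 ^ cls n P) ^+ k)%g.
  by rewrite !cls_cat cls_inv cls_pow -conjXg.
have vL g : valid_word n g -> valid_word n (pow_word (half_twist g) (2 * k)).
  by move=> vg; apply/valid_pow/valid_half_twist.
have vR P : valid_word n P ->
    valid_word n (inv_word P ++ pow_word (a_word n.-1) k ++ P).
  by move=> vP; rewrite !valid_cat valid_inv_word vP valid_pow ?valid_a_word.
split=> [[g [vg [pg /(cls_beq vb (vL g vg)) e]]]|
  [_ [P [vP [AP /(cls_beq vb (vR P vP)) e]]]]].
  have [Q [s vs eQ] eg] := half_twist_sqr n1 vg pg.
  have hQ : inA Q by exists s.
  have vs' := valid_a_eval vs.
  split; first by apply/in_AP => //; rewrite e clsL eg; apply/inAX/inAJ.
  exists (a_eval s); split=> //; split; first by apply/in_AP => //; exists s.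
  by apply/cls_beq => //; [exact: vR|rewrite e clsL eg eQ clsR].
(* The word [tail_word n.-2] is $\sigma_2\cdots\sigma_{n-1}$, empty when $n=2$; it carries the point
   1 to $n-1$. *)
have en : n.-2.+2 = n by lia.
have uN : n.-2.+1 < n by rewrite en.
have vt : valid_word n (tail_word n.-2) by apply/valid_upper/upper_tail.
have vg : valid_word n (tail_word n.-2 ++ P) by rewrite valid_cat vt vP.
exists (tail_word n.-2 ++ P); split => //; split; last first.
  apply/cls_beq => //; first exact: vL.
  rewrite e clsL clsR cls_cat conjgM; congr ((_ ^ _) ^+ _)%g.
  rewrite conjXg sigma1J_tail // -conjXg -agenE; congr (agen n); lia.
(* Elements of $A_n$ are pure, so conjugating by [P] leaves the permutation of the half-twist
   unchanged. *)
have eP : perm_of_braid n P = 1%g.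
  by case: AP => s [vs /(cls_beq vP (valid_a_eval vs))/perm_cls->]; exact: perm_a_eval.
have nN' : n.-1 < n by lia.
pose o0 := Ordinal n0; pose o1 := Ordinal n1; pose om := Ordinal nN'.
have -> : tr n 1 n = tperm o0 om by rewrite -(tr_tperm o0 om) /= prednK.
rewrite (@perm_half_twist n _ o0 o1) // perm_cat eP mulg1.
congr tperm; apply: val_inj => /=.
- exact: perm_upper (upper_tail uN) _.
- by rewrite perm_tail //; lia.
Qed.
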